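(* Let $n \geq 1$ be an integer, let $A = (a_{ij})_{i,j\in\mathbb{N}}$ be the naive matrix of Type $(3, 2^n-1)$, and put $s = 2^{n+1}-1$ and $d = (2^{n+1}-1)(2^n-1)/3$. For $i \in \mathbb{N}$ let $L_i = \{ j \in \mathbb{N} : a_{ij} = 1\}$. Then the map $i \mapsto L_i \cup \{0\}$ is a bijection from $\{1,\dots,d\}$ onto the set of all subgroups of order $4$ of the elementary abelian $2$-group $(\{0,1,\dots,s\}, \oplus)$ of order $2^{n+1}$. Consequently, the upper left $d \times s$ submatrix $(a_{ij})_{1\le i\le d,\, 1\le j\le s}$ of $A$ is an incidence matrix of the points and lines of the projective space $PG(n,2)$, the columns corresponding to the points and the rows to the lines.
   Context: $\mathbb{N} = \{1,2,3,\dots\}$. For $k, r \in \mathbb{N}$, the naive matrix of Type $(k,r)$ is the unique $\mathbb{N}\times\mathbb{N}$-matrix $A = (a_{ij})_{i,j\in\mathbb{N}}$ with entries in $\{0,1\}$ such that $a_{ij} = 1$ if and only if none of the following three conditions holds: (i) there exist $i' < i$ and $j' < j$ such that $a_{i,j'} = a_{i',j} = a_{i',j'} = 1$; (ii) $\sum_{j'<j} a_{i,j'} \geq k$; (iii) $\sum_{i'<i} a_{i',j} \geq r$. (Sums are of integers.) The symbol $\oplus$ denotes Nim addition on the non-negative integers, i.e. addition of binary expansions digitwise modulo 2 without carry (bitwise XOR). $PG(n,2)$ is the $n$-dimensional projective space over the field with two elements: its points and lines are the $1$- and $2$-dimensional subspaces of an $(n+1)$-dimensional vector space over $GF(2)$.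 *)

(* Defs.v *)
From HB Require Import structures.
From Stdlib Require PeanoNat.
From mathcomp Require Import all_boot all_order all_algebra all_fingroup all_solvable.
From mathcomp Require Import boolp classical_sets functions.
From mathcomp Require Import zify.

Set Implicit Arguments.
Unset Strict Implicit.
Unset Printing Implicit Defensive.

Local Open Scope nat_scope.
Local Open Scope classical_set_scope.

(* Rows and columns are numbered from 1, as in an N x N matrix with
   N = {1, 2, 3, ...}; the values of [a] at index 0 are never used.  A boolean
   entry is 0 or 1, and the sums coerce it to [nat]. *)
Definition naive_matrix (k r : nat) (a : nat -> nat -> bool) : Prop :=
  forall i j, 1 <= i -> 1 <= j ->
    (a i j <->
     ~ [\/ exists i' j', [/\ 1 <= i' < i, 1 <= j' < j,
                             a i j', a i' j & a i' j'],
           k <= \sum_(1 <= j' < j) a i j'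
         | r <= \sum_(1 <= i' < i) a i' j]).

Section NaiveMatrixWellDefined.

Variables k r : nat.

Let rule (b : nat -> nat -> bool) (i j : nat) : bool :=
  `[< ~ [\/ exists i' j', [/\ 1 <= i' < i, 1 <= j' < j,
                              b i j', b i' j & b i' j'],
            k <= \sum_(1 <= j' < j) b i j'
          | r <= \sum_(1 <= i' < i) b i' j] >].

Let rule_ext b c i j :
    (forall i' j', 1 <= i' <= i -> 1 <= j' <= j -> i' + j' < i + j ->
       b i' j' = c i' j') ->
  1 <= i -> 1 <= j -> rule b i j = rule c i j.
Proof.
move=> bc i1 j1; rewrite /rule.
have -> : \sum_(1 <= j' < j) b i j' = \sum_(1 <= j' < j) c i j'.
  by apply: eq_big_nat => j' hj; rewrite bc//; lia.
have -> : \sum_(1 <= i' < i) b i' j = \sum_(1 <= i' < i) c i' j.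
  by apply: eq_big_nat => i' hi; rewrite bc//; lia.
apply: asbool_equiv_eq; split; apply: contra_not; case=> H;
  try (by apply: Or32); try (by apply: Or33);
  apply: Or31; case: H => i' [j' [hi hj]] h1 h2 h3;
  exists i', j'; split=> //.
- by rewrite bc//; lia.
- by rewrite bc//; lia.
- by rewrite bc//; lia.
- by rewrite -bc//; lia.
- by rewrite -bc//; lia.
- by rewrite -bc//; lia.
Qed.

Lemma naive_matrix_exists : exists a, naive_matrix k r a.
Proof.
pose F := fix F m := if m is p.+1 then rule (F p) else fun _ _ => false.
have stab m p i j : 1 <= i -> 1 <= j -> i + j <= m -> i + j <= p ->
    F m i j = F p i j.
  elim: m p i j => [|m IH] [|p] i j i1 j1 hm hp; try lia.
  by apply: rule_ext => // i' j' hi hj hlt; apply: IH; lia.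
exists (fun i j => F (i + j) i j) => i j i1 j1.
have -> : F (i + j) i j = rule (fun i j => F (i + j) i j) i j.
  have -> : F (i + j) i j = F (i + j).+1 i j by apply: stab; lia.
  by apply: rule_ext => // i' j' hi hj hlt; apply: stab; lia.
by split=> /asboolP.
Qed.

Lemma naive_matrix_unique a b : naive_matrix k r a -> naive_matrix k r b ->
  forall i j, 1 <= i -> 1 <= j -> a i j = b i j.
Proof.
move=> na nb i j.
move: {2}(i + j) (leqnn (i + j)) => m.
elim: m i j => [|m IH] i j hm i1 j1; first lia.
have -> : a i j = rule a i j.
  by apply/idP/asboolP => [/(na _ _ i1 j1)|/(na _ _ i1 j1)].
have -> : b i j = rule b i j.
  by apply/idP/asboolP => [/(nb _ _ i1 j1)|/(nb _ _ i1 j1)].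
by apply: rule_ext => // i' j' hi hj hlt; apply: IH; lia.
Qed.

End NaiveMatrixWellDefined.

Definition row_support (a : nat -> nat -> bool) (i : nat) : set nat :=
  [set j | 1 <= j /\ a i j].

Definition upper_left (d s : nat) (a : nat -> nat -> bool) : 'M[bool]_(d, s) :=
  \matrix_(i < d, j < s) a i.+1 j.+1.

(* The set {0, ..., 2 ^ m - 1} with Nim addition, as a finite group in
   MathComp's multiplicative notation.  It is a copy of ['I_(2 ^ m)], so that
   this group law does not get attached to the ordinals themselves. *)
Record nim (m : nat) : Type := Nim { ord_of_nim :> 'I_(2 ^ m) }.

HB.instance Definition _ m := [isNew for @ord_of_nim m].
HB.instance Definition _ m := [Finite of nim m by <:].

Section NimGroup.

Variable m : nat.

Fact nim_add_subproof (x y : nim m) : PeanoNat.Nat.lxor x y < 2 ^ m.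
Proof.
have pE p : 2 ^ p = PeanoNat.Nat.pow 2 p.
  by elim: p => // p IH; rewrite expnS IH /=; lia.
have lg z : 0 < z -> z < 2 ^ m -> PeanoNat.Nat.log2 z < m.
  move=> z0 hz; apply/ltP/PeanoNat.Nat.log2_lt_pow2; first by apply/ltP.
  by rewrite -pE; apply/ltP.
case: x y => [[x hx]] [[y hy]] /=.
have [->|x0] := posnP x; first by rewrite PeanoNat.Nat.lxor_0_l.
have [->|y0] := posnP y; first by rewrite PeanoNat.Nat.lxor_0_r.
have [->|z0] := posnP (PeanoNat.Nat.lxor x y); first by rewrite expn_gt0.
rewrite pE; apply/ltP/PeanoNat.Nat.log2_lt_pow2; first by apply/ltP.
have := PeanoNat.Nat.log2_lxor x y.
have := lg _ x0 hx; have := lg _ y0 hy; lia.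
Qed.

Definition nim_add (x y : nim m) : nim m :=
  Nim (Ordinal (nim_add_subproof x y)).

Fact nim_zero_subproof : 0 < 2 ^ m. Proof. by rewrite expn_gt0. Qed.

Definition nim_zero : nim m := Nim (Ordinal nim_zero_subproof).

Fact nim_addA : associative nim_add.
Proof.
by move=> x y z; do 2!apply: val_inj; rewrite /= PeanoNat.Nat.lxor_assoc.
Qed.

Fact nim_add0 : left_id nim_zero nim_add.
Proof. by move=> x; do 2!apply: val_inj; rewrite /= PeanoNat.Nat.lxor_0_l. Qed.

Fact nim_addK : left_inverse nim_zero id nim_add.
Proof. by move=> x; do 2!apply: val_inj; rewrite /= PeanoNat.Nat.lxor_nilpotent. Qed.

HB.instance Definition _ :=
  Finite_isGroup.Build (nim m) nim_addA nim_add0 nim_addK.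

End NimGroup.

Definition nim_subset (m : nat) (H : {group nim m}) : set nat :=
  [set j : nat | exists2 x : nim m, x \in H & j = x].

Definition nim_subgroups (m q : nat) : set (set nat) :=
  [set nim_subset H | H in [set H : {group nim m} | #|H| = q]].

Definition incidence_matrix (d s : nat) (P B : Type) (points : set P)
    (blocks : set B) (inc : P -> B -> Prop) (M : 'M[bool]_(d, s)) : Prop :=
  exists (pt : 'I_s -> P) (bl : 'I_d -> B),
    [/\ set_bij setT points pt,
        set_bij setT blocks bl
      & forall i j, M i j <-> inc (pt j) (bl i)].

(* For [V] of dimension n + 1 these are the points and lines of PG(n, 2). *)
Definition PG_points (V : vectType 'F_2) : set {vspace V} :=
  [set p | \dim p = 1].

Definition PG_lines (V : vectType 'F_2) : set {vspace V} :=
  [set l | \dim l = 2].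

Definition PG_incident (V : vectType 'F_2) (p l : {vspace V}) : Prop :=
  (p <= l)%VS.

(* Main.v *)
Require Import Defs.
From mathcomp Require Import all_boot all_order all_algebra all_fingroup all_solvable.
From mathcomp Require Import mxabelem.
From mathcomp Require Import boolp classical_sets functions.
From mathcomp Require Import zify.
Import GRing.Theory VectorInternalTheory.

Set Implicit Arguments.
Unset Strict Implicit.
Unset Printing Implicit Defensive.

Local Open Scope nat_scope.
Local Open Scope classical_set_scope.

(** Write N = 2 ^ (n + 1).  Two distinct points x and y of {1, ..., N - 1} lie on
    exactly one triple {x, y, x xor y}, so these triples, the nonzero parts of
    the subgroups of order 4, are the lines of a Steiner triple system.
    Counting pairs shows that every point is on (N - 2) / 2 = 2 ^ n - 1 lines
    ([degE]) and that there are d lines ([size_lines]).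

    Write each line in increasing order, A < B < C with C = A xor B, and sort
    the lines lexicographically.  The core of the proof is that row i of the
    naive matrix is the i-th line in this order ([naive_rows]), by induction on
    i and, inside the row, on the column j:
    - a column j < A is full, since all lines through j have a least point
      smaller than A and so come earlier;
    - a column j with A < j < B has met column A in an earlier row, since the
      line through A and j precedes the i-th line;
    - for B < j < C, the fact that A xor B is the least number different from
      all a' xor B (a' < A) and all A xor b' (b' < B) gives j xor B < A or
      A xor j < B ([nim_mex]), so that the line through B and j, or the line
      through A and j, precedes the i-th line;
    - after column C the row has reached its bound 3;
    - at A, B and C no condition applies: two lines share at most one point,
      the row sum is at most 2, and the i-th line is one of the 2 ^ n - 1 lines
      through the point, so that at most 2 ^ n - 2 of them come before.

    The subgroups of order 4 are read off from this ([rows_subgroups]).  For the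
    projective space, any isomorphism from the Nim group onto V carries Nim sums
    to sums of vectors ([nim_coordinates]); over the field with two elements a
    point has one nonzero vector and a line three, summing to 0
    ([rows_incidence]). *)

(** * Nim addition *)

Notation "x ⊕ y" := (PeanoNat.Nat.lxor x y)
  (at level 50, left associativity) : nat_scope.

Lemma half_nim x y : (x ⊕ y)./2 = x./2 ⊕ y./2.
Proof.
have halfE z : z./2 = PeanoNat.Nat.shiftr z 1.
  rewrite -PeanoNat.Nat.div2_spec; elim/ltn_ind: z => -[|[|z]] //= IH.
  by rewrite -IH// -uphalfE.
by rewrite !halfE PeanoNat.Nat.shiftr_lxor.
Qed.

Lemma odd_nim x y : odd (x ⊕ y) = odd x (+) odd y.
Proof.
have oddE z : odd z = PeanoNat.Nat.testbit z 0.
  rewrite PeanoNat.Nat.bit0_odd; elim/ltn_ind: z => -[|[|z]] //= IH.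
  by rewrite negbK IH.
by rewrite !oddE PeanoNat.Nat.lxor_spec; do 2 case: PeanoNat.Nat.testbit.
Qed.

Lemma nimxx x : x ⊕ x = 0. Proof. exact: PeanoNat.Nat.lxor_nilpotent. Qed.
Lemma nimC : commutative PeanoNat.Nat.lxor. Proof. exact: PeanoNat.Nat.lxor_comm. Qed.
Lemma nimA : associative PeanoNat.Nat.lxor.
Proof. by move=> x y z; rewrite PeanoNat.Nat.lxor_assoc. Qed.
Lemma nimx0 x : x ⊕ 0 = x. Proof. exact: PeanoNat.Nat.lxor_0_r. Qed.
Lemma nim0x x : 0 ⊕ x = x. Proof. exact: PeanoNat.Nat.lxor_0_l. Qed.
Lemma nimKl x y : x ⊕ (x ⊕ y) = y. Proof. by rewrite nimA nimxx nim0x. Qed.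
Lemma nimKr x y : x ⊕ y ⊕ y = x. Proof. by rewrite -nimA nimxx nimx0. Qed.

Lemma ltn_half u v :
  (u < v) = (u./2 < v./2) || [&& u./2 == v./2, ~~ odd u & odd v].
Proof.
rewrite -[u in LHS]odd_double_half -[v in LHS]odd_double_half.
by case: (odd u) (odd v) (u./2) (v./2) => -[] p q /=; lia.
Qed.

(** In other words, a xor b is the least number different from all a' xor b with
    a' < a and all a xor b' with b' < b.  At the highest digit where y and
    a xor b differ, y has 0, so exactly one of a and b has 1; replacing that one
    by its Nim sum with a xor b xor y makes it smaller. *)
Lemma nim_mex a b y : y < a ⊕ b -> (y ⊕ b < a) || (a ⊕ y < b).
Proof.
elim/ltn_ind: y a b => y IH a b lt.
have [y0|y0] := posnP y.
  move: lt; rewrite y0 nim0x nimx0.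
  by have [//|//|->] := ltngtP b a; rewrite nimxx.
have hb := half_nim a b; have ob := odd_nim a b.
have hy := half_nim y b; have oy := odd_nim y b.
have ha := half_nim a y; have oa := odd_nim a y.
have y2 : y./2 < y by clear -y0; lia.
(* either y / 2 is already smaller than (a xor b) / 2, or the two halves agree
   and the last digit decides *)
move: lt; rewrite (ltn_half y) (ltn_half _ a) (ltn_half _ b) hb ob hy oy ha oa.
move=> /orP[/(IH _ y2)/orP[]->|]; rewrite ?orbT//.
case/and3P=> /eqP -> /negPf -> {IH hb ob hy oy ha oa y2}.
by rewrite nimKr nimKl !eqxx; case: (odd a) (odd b) => -[]; rewrite ?orbT.
Qed.

Lemma nim_eq0 x y : (x ⊕ y == 0) = (x == y).
Proof.
apply/eqP/eqP => [e|->]; last exact: nimxx.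
by rewrite -[x](nimKr x y) e nim0x.
Qed.

Lemma nim_bound m x y : x < 2 ^ m -> y < 2 ^ m -> x ⊕ y < 2 ^ m.
Proof.
move=> hx hy.
exact: (@nim_add_subproof m (Nim (Ordinal hx)) (Nim (Ordinal hy))).
Qed.

(** * Triples with Nim sum zero *)

Definition tri a b := [:: a; b; a ⊕ b].
Definition ordered_tri a b := [&& 0 < a, a < b & b < a ⊕ b].

Lemma mem_tri a b x : (x \in tri a b) = [|| x == a, x == b | x == a ⊕ b].
Proof. by rewrite !inE. Qed.

(** Each point of a triple is the Nim sum of the two others, so any two of its
    points generate it. *)
Lemma tri_nim a b x y : x \in tri a b -> y \in tri a b -> x != y ->
  tri a b =i tri x y.
Proof.
have e3 : b ⊕ (a ⊕ b) = a by rewrite (nimC a) nimKl.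
have e4 : a ⊕ b ⊕ a = b by rewrite (nimC a) nimKr.
rewrite !mem_tri => /or3P[] /eqP-> /or3P[] /eqP->; rewrite ?eqxx// => _ z;
  rewrite !mem_tri ?nimKl ?nimKr ?(nimC b a) ?e3 ?e4 //;
  by do ![case: eqP => //].
Qed.

Lemma sort_tri x y : 0 < x -> 0 < y -> x != y ->
  exists2 p, ordered_tri p.1 p.2 & tri p.1 p.2 =i tri x y.
Proof.
wlog lt : x y / x < y => [th|] x0 y0 xy.
  have [lt|lt|/eqP] := ltngtP x y; last by rewrite (negPf xy).
    exact: th.
  have [|p op e] := th _ _ lt y0 x0; first by rewrite eq_sym.
  by exists p => // z; rewrite e !mem_tri (nimC y) orbCA.
have z0 : 0 < x ⊕ y by rewrite lt0n nim_eq0.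
have zx : (x ⊕ y == x) = false.
  by rewrite -nim_eq0 (nimC x) nimKr gtn_eqF.
have zy : (x ⊕ y == y) = false by rewrite -nim_eq0 nimKr gtn_eqF.
have [lxz|lzx|/esym/eqP] := ltngtP x (x ⊕ y); last by rewrite zx.
- have [lyz|lzy|/esym/eqP] := ltngtP y (x ⊕ y); last by rewrite zy.
    by exists (x, y) => //; apply/and3P; split.
  exists (x, x ⊕ y) => /=; first by apply/and3P; split; rewrite ?nimKl.
  by move=> z; rewrite !mem_tri nimKl [(z == y) || _]orbC.
- exists (x ⊕ y, x) => /=; last first.
    by move=> z; rewrite !mem_tri (nimC _ x) nimKl orbC -orbA.
  by apply/and3P; split; rewrite ?[_ ⊕ x]nimC ?nimKl.
Qed.

Lemma ordered_tri_sorted a b : ordered_tri a b -> sorted ltn (tri a b).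
Proof. by case/and3P=> _ h1 h2; rewrite /= h1 h2. Qed.

(** An increasing triple can be recovered by sorting its set of points. *)
Lemma ordered_tri_inj a b a' b' : ordered_tri a b -> ordered_tri a' b' ->
  tri a b =i tri a' b' -> (a, b) = (a', b').
Proof.
move=> /ordered_tri_sorted h /ordered_tri_sorted h' e.
by have [-> ->] := irr_sorted_eq ltn_trans ltnn h h' e.
Qed.

Lemma sum_mem_tri a b M : ordered_tri a b ->
  \sum_(1 <= j < M) (j \in tri a b) = (a < M) + (b < M) + (a ⊕ b < M).
Proof.
case/and3P=> a0 ab bc; case: M => [|M]; first by rewrite big_geq.
elim: M => [|M IH]; first by rewrite big_geq //; lia.
by rewrite big_nat_recr//= IH mem_tri; lia.
Qed.

Lemma sum_pred (T : Type) (P : pred T) (s : seq T) :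
  \sum_(x <- s) P x = count P s.
Proof. by elim: s => [|x s IH]; rewrite ?big_nil// big_cons IH. Qed.

Lemma ltn_pred_size x n : 0 < x <= n -> x.-1 < n.
Proof. by case: x. Qed.

(** * The lines as a Steiner triple system *)

Section Lines.
Variable m : nat.
Local Notation N := (2 ^ m).

(** The line with increasing points A, B, A xor B is encoded by the number
    A * N + B, so that the order of the codes is the lexicographic order of the
    lines and the enumeration of [lines] is a filtered interval. *)
Definition fst_pt k := k %/ N.
Definition snd_pt k := k %% N.
Definition line k := tri (fst_pt k) (snd_pt k).
Definition lines :=
  [seq k <- iota 0 (N * N) | ordered_tri (fst_pt k) (snd_pt k)].

Lemma N_gt0 : 0 < N. Proof. by rewrite expn_gt0. Qed.

Lemma lines_sorted : sorted ltn lines.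
Proof. exact/(sorted_filter ltn_trans)/iota_ltn_sorted. Qed.

Lemma lines_uniq : uniq lines.
Proof. by rewrite filter_uniq// iota_uniq. Qed.

Lemma lines_ordered k : k \in lines -> ordered_tri (fst_pt k) (snd_pt k).
Proof. by rewrite mem_filter => /andP[]. Qed.

Lemma line_bound k j : k \in lines -> j \in line k -> 0 < j < N.
Proof.
rewrite mem_filter mem_iota /= add0n mem_tri => /andP[/and3P[a0 ab bc] kN].
have aN : fst_pt k < N by rewrite ltn_divLR ?N_gt0.
have bN : snd_pt k < N by rewrite ltn_mod N_gt0.
have cN := nim_bound aN bN.
by case/or3P=> /eqP ->; lia.
Qed.

Lemma line_of_pair x y : 0 < x < N -> 0 < y < N -> x != y ->
  exists2 k, k \in lines & line k =i tri x y.
Proof.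
move=> /andP[x0 xN] /andP[y0 yN] xy.
have [[a b] /= op e] := sort_tri x0 y0 xy.
have bd z : z \in tri a b -> z < N.
  by rewrite e mem_tri => /or3P[] /eqP-> //; apply: nim_bound.
have aN : a < N by rewrite bd// mem_tri eqxx.
have bN : b < N by rewrite bd// mem_tri eqxx orbT.
have ea : fst_pt (a * N + b) = a.
  by rewrite /fst_pt divnMDl ?N_gt0// divn_small// addn0.
have eb : snd_pt (a * N + b) = b by rewrite /snd_pt modnMDl modn_small.
exists (a * N + b); last by rewrite /line ea eb.
rewrite mem_filter ea eb op mem_iota /= add0n.
apply: (@leq_trans (a.+1 * N)); first by rewrite mulSn addnC ltn_add2r.
by rewrite leq_mul2r aN orbT.
Qed.

Lemma line_inj k l : k \in lines -> l \in lines -> line k =i line l -> k = l.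
Proof.
move=> /lines_ordered hk /lines_ordered hl /(ordered_tri_inj hk hl)[e1 e2].
by rewrite (divn_eq k N) (divn_eq l N) -/(fst_pt k) e1 -/(snd_pt k) e2.
Qed.

Lemma line_unique k l x y : k \in lines -> l \in lines -> x != y ->
  x \in line k -> y \in line k -> x \in line l -> y \in line l -> k = l.
Proof.
move=> hk hl xy xk yk xl yl; apply: line_inj => // z.
by rewrite (tri_nim xk yk xy) (tri_nim xl yl xy).
Qed.

Definition deg j := count (fun k => j \in line k) lines.

Lemma count_pair x y : 0 < x < N -> 0 < y < N -> x != y ->
  count (fun k => (x \in line k) && (y \in line k)) lines = 1.
Proof.
move=> hx hy xy; have [l hl e] := line_of_pair hx hy xy.
have xl : x \in line l by rewrite e mem_tri eqxx.
have yl : y \in line l by rewrite e mem_tri eqxx orbT.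
rewrite (@eq_in_count _ _ (pred1 l)) ?count_uniq_mem ?lines_uniq ?hl// => k hk /=.
apply/andP/eqP => [[xk yk]|->//].
exact: (line_unique hk hl xy).
Qed.

Lemma sum_line k : k \in lines -> \sum_(1 <= j < N) (j \in line k) = 3.
Proof.
move=> hk; rewrite sum_mem_tri ?lines_ordered//.
have bd j : j \in line k -> j < N by case/(line_bound hk)/andP.
by rewrite !bd// mem_tri eqxx ?orbT.
Qed.

(** Count the pairs of a point x and a line through both j and x.  By lines
    there are 3 * deg j of them; by points, deg j for x = j and one for each of
    the N - 2 other points. *)
Lemma degE j : 0 < j < N -> (deg j).*2 = N - 2.
Proof.
move=> hj.
have : \sum_(1 <= x < N) count (fun k => (j \in line k) && (x \in line k)) lines
    = deg j * 3.
  under eq_bigr do rewrite -sum_pred.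
  rewrite exchange_big /deg -sum_pred big_distrl /=.
  apply: eq_big_seq => k hk; case: (j \in line k) => /=; last by rewrite big1.
  by rewrite sum_line.
rewrite (bigD1_seq j) ?iota_uniq ?mem_index_iota//=.
rewrite (eq_count (fun k => andbb (j \in line k))) -/(deg j).
rewrite big_seq_cond (eq_bigr (fun=> 1)) => [|x]; last first.
  by rewrite mem_index_iota => /andP[hx xj]; rewrite count_pair// eq_sym.
rewrite -big_seq_cond sum1_count.
have := count_predC (pred1 j) (index_iota 1 N).
rewrite count_uniq_mem ?iota_uniq// mem_index_iota hj size_iota.
rewrite (_ : count (predC _) _ = count (fun x => x != j) (index_iota 1 N))//.
by move: (count _ _) => c /=; lia.
Qed.

(** Count the incident pairs of a point and a line by lines and by points. *)
Lemma size_lines j : 0 < j < N -> 3 * size lines = (N - 1) * deg j.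
Proof.
move=> hj.
have -> : 3 * size lines = \sum_(k <- lines) \sum_(1 <= x < N) (x \in line k).
  rewrite big_seq (eq_bigr (fun=> 3)) => [|k /sum_line//].
  by rewrite -big_seq big_const_seq count_predT iter_addn_0 mulnC.
rewrite exchange_big big_seq (eq_bigr (fun=> deg j)) => [|x]; last first.
  rewrite mem_index_iota => hx; rewrite sum_pred.
  by apply: double_inj; rewrite !degE.
by rewrite -big_seq sum_nat_const_nat.
Qed.

(** * The lexicographic order of the lines *)

Lemma nth_lines_leq p q : p <= q -> q < size lines ->
  nth 0 lines p <= nth 0 lines q.
Proof.
rewrite leq_eqVlt => /predU1P[->//|pq] hq.
have hp := ltn_trans pq hq.
exact/ltnW/(sorted_ltn_nth ltn_trans 0 lines_sorted).
Qed.

(** Rows are numbered from 1, the sequence [lines] from 0. *)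
Definition nth_line i := line (nth 0 lines i.-1).

Lemma nth_line_in i : 0 < i <= size lines -> nth 0 lines i.-1 \in lines.
Proof. by move/ltn_pred_size; apply: mem_nth. Qed.

Lemma nth_line_before k i : k \in lines -> k < nth 0 lines i.-1 ->
  0 < i <= size lines -> exists2 i', 0 < i' < i & nth_line i' = line k.
Proof.
move=> hk lt hi; exists (index k lines).+1; last by rewrite /nth_line nth_index.
rewrite ltnS leq0n /= ltnNge; apply: contraL lt => le; rewrite -leqNgt.
rewrite -[k in _ <= k](nth_index 0 hk).
by apply: nth_lines_leq; rewrite ?index_mem//; lia.
Qed.

Lemma nth_line_inj i i' : 0 < i <= size lines -> 0 < i' <= size lines ->
  nth_line i =i nth_line i' -> i = i'.
Proof.
move=> hi hi' /(line_inj (nth_line_in hi) (nth_line_in hi')) /eqP.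
by rewrite nth_uniq ?lines_uniq ?ltn_pred_size// => /eqP; lia.
Qed.

Lemma nth_line_exists k : k \in lines ->
  exists2 i, 0 < i <= size lines & nth_line i = line k.
Proof.
move=> hk; exists (index k lines).+1; last by rewrite /nth_line nth_index.
by rewrite index_mem.
Qed.

Lemma sum_nth_line i j : 0 < i <= (size lines).+1 ->
  \sum_(1 <= i' < i) (j \in nth_line i') =
  count (fun k => j \in line k) (take i.-1 lines).
Proof.
case: i => // i /=; rewrite ltnS => hi.
rewrite big_add1 -sum_pred [RHS](big_nth 0) size_takel//=.
by apply: eq_big_nat => i' hi'; rewrite /nth_line nth_take//; lia.
Qed.

Lemma sum_nth_line_lt i j : 0 < i <= size lines -> j \in nth_line i ->
  \sum_(1 <= i' < i) (j \in nth_line i') < deg j.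
Proof.
case: i => // i hi jr; rewrite sum_nth_line; last by lia.
rewrite /deg -{2}(cat_take_drop i lines) count_cat (drop_nth 0)//=.
by rewrite -/(nth_line i.+1) jr; lia.
Qed.

(** The lines from the i-th one on have a first point greater than j, and hence
    miss j. *)
Lemma sum_nth_line_full i j :
  0 < i <= size lines -> j < fst_pt (nth 0 lines i.-1) ->
  \sum_(1 <= i' < i) (j \in nth_line i') = deg j.
Proof.
move=> hi jlt; rewrite sum_nth_line; last by lia.
rewrite /deg -[in RHS](cat_take_drop i.-1 lines) count_cat.
rewrite [X in _ = _ + X](_ : _ = 0) ?addn0//.
apply/eqP; rewrite -leqn0 leqNgt -has_count; apply/hasPn => k /(nthP 0)[p].
rewrite size_drop nth_drop ltn_subRL => hp <-.
set l := nth 0 lines (_ + p).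
have hl : l \in lines by apply: mem_nth.
have hle : nth 0 lines i.-1 <= l by rewrite nth_lines_leq ?leq_addr.
have : j < fst_pt l by apply: leq_trans jlt (leq_div2r _ hle).
have /and3P[] := lines_ordered hl.
by rewrite /line mem_tri; lia.
Qed.

(** A point y on k bounds the least point of k; if k has that same least point
    as l, another point z bounds the second point of k. *)
Lemma line_lt k l y z : k \in lines -> l \in lines -> y \in line k ->
  y < fst_pt l \/ [/\ y = fst_pt l, z \in line k, z != y & z < snd_pt l] ->
  k < l.
Proof.
move=> /lines_ordered/and3P[a0 ab bc] /lines_ordered/and3P[a0' ab' bc'] yk H.
rewrite [k in k < l](divn_eq k N) [l in _ < l](divn_eq l N).
rewrite -!/(fst_pt _) -!/(snd_pt _).
have hlt : snd_pt k < N by rewrite ltn_mod N_gt0.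
have [lt|[e lt]] : fst_pt k < fst_pt l \/
    fst_pt k = fst_pt l /\ snd_pt k < snd_pt l.
  move: yk H ab bc; rewrite /line !mem_tri.
  move: (_ ⊕ _) => c {a0 a0' ab' bc' hlt}.
  by move=> hy; case=> [lt|[e hz zy zb]]; lia.
- apply: (@leq_trans ((fst_pt k).+1 * N)); first by rewrite mulSn addnC ltn_add2r.
  by rewrite (leq_trans _ (leq_addr _ _))// leq_mul2r lt orbT.
- by rewrite e ltn_add2l.
Qed.

(** * The rows of the naive matrix *)

(** The matrix is only known on the rows above and on the columns to the left,
    which is what the double induction provides; a column j beyond the points of
    the geometry falls under the case where the row has reached its bound. *)
Lemma naive_rows r (a : nat -> nat -> bool) :
  (forall j, 0 < j < N -> deg j = r) -> naive_matrix 3 r a ->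
  forall i j, 0 < i <= size lines -> 0 < j -> a i j = (j \in nth_line i).
Proof.
move=> degr na i; elim/ltn_ind: i => i IHi j hi j0; elim/ltn_ind: j j0 => j IHj j0.
have i1 : 0 < i by case/andP: hi.
have IHr i' j' : 0 < i' < i -> 0 < j' -> a i' j' = (j' \in nth_line i').
  by move=> hi' hj'; apply: IHi => //; lia.
have sumr : \sum_(1 <= j' < j) a i j' = \sum_(1 <= j' < j) (j' \in nth_line i).
  by apply: eq_big_nat => j' hj'; rewrite IHj//; lia.
have sumc : \sum_(1 <= i' < i) a i' j = \sum_(1 <= i' < i) (j \in nth_line i').
  by apply: eq_big_nat => i' hi'; rewrite IHr.
have hl := nth_line_in hi.
have op := lines_ordered hl.
pose A := fst_pt (nth 0 lines i.-1); pose B := snd_pt (nth 0 lines i.-1).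
have /and3P[A0 AB BC] : ordered_tri A B := op.
apply/idP/idP => [/(na i j i1 j0)|jr].
  rewrite sumr sumc; apply: contra_notT => jr.
  (* an earlier line through j and a point y < j of the row completes a
     rectangle *)
  have earlier k y : k \in lines -> y \in nth_line i -> 0 < y < j -> j \in line k ->
      y \in line k -> k < nth 0 lines i.-1 ->
      exists i' j', [/\ 1 <= i' < i, 1 <= j' < j, a i j', a i' j & a i' j'].
    move=> hk yr hy jk yk klt.
    have [i' hi' e] := nth_line_before hk klt hi.
    case/andP: (hy) => y0 yj.
    exists i', y; rewrite (IHr i' j)// (IHr i' y)// (IHj y)// !e.
    by split=> //; apply/andP.
  have [jA|Aj] := ltnP j A.
    apply: Or33; rewrite sum_nth_line_full// degr ?leqnn//.
    have : A \in nth_line i by rewrite mem_tri eqxx.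
    by move/(line_bound hl); lia.
  have Ar : A \in nth_line i by rewrite mem_tri eqxx.
  have Br : B \in nth_line i by rewrite mem_tri eqxx orbT.
  have [jC|Cj] := ltnP (A ⊕ B) j.
    by apply: Or32; rewrite sum_mem_tri// -/A -/B; lia.
  apply: Or31.
  move: jr; rewrite mem_tri !negb_or => /and3P[jA jB jC].
  have [_ AN] := andP (line_bound hl Ar).
  have [_ BN] := andP (line_bound hl Br).
  have Cr : A ⊕ B \in nth_line i by rewrite mem_tri eqxx !orbT.
  have [_ CN] := andP (line_bound hl Cr).
  (* A < j < B: the line through A and j *)
  have [jltB|jgtB] := ltnP j B.
    have [||//|k hk e] := @line_of_pair A j; try lia.
    apply: (earlier k _ hk Ar); rewrite ?e ?mem_tri ?eqxx ?orbT//; try lia.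
    apply: (line_lt hk hl (y := A) (z := j)).
      by rewrite e mem_tri eqxx.
    by right; rewrite e mem_tri eqxx orbT.
  (* B < j < A xor B *)
  have [|h|h] := orP (nim_mex (_ : j < A ⊕ B)).
    by rewrite ltn_neqAle jC.
    (* the line through B and j contains j xor B, which is below A *)
    have [||//|k hk e] := @line_of_pair B j; try lia.
    apply: (earlier k _ hk Br); rewrite ?e ?mem_tri ?eqxx ?orbT//; try lia.
    apply: (line_lt hk hl (y := j ⊕ B) (z := j)); last by left.
    by rewrite e mem_tri nimC eqxx !orbT.
  (* the line through A and j contains A xor j, which is below B *)
  have [||//|k hk e] := @line_of_pair A j; try lia.
  apply: (earlier k _ hk Ar); rewrite ?e ?mem_tri ?eqxx ?orbT//; try lia.
  apply: (line_lt hk hl (y := A) (z := A ⊕ j)).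
    by rewrite e mem_tri eqxx.
  right; rewrite e mem_tri eqxx !orbT; split=> //.
  by rewrite -nim_eq0 nimC nimKl; lia.
apply/(na i j i1 j0); rewrite sumr sumc; case.
- case=> i' [j' [hi' hj']]; rewrite IHj ?IHr//; try lia.
  move=> j'r ji' j'i'.
  suff : i' = i by lia.
  have hi'' : 0 < i' <= size lines by lia.
  apply: nth_line_inj => // z.
  have jj : j != j' by lia.
  by rewrite (tri_nim jr j'r jj) (tri_nim ji' j'i' jj).
- rewrite sum_mem_tri//; move: jr; rewrite mem_tri -/A -/B.
  by case/or3P=> /eqP ->; lia.
- have := line_bound hl jr => hj.
  by apply/negP; rewrite -ltnNge -(degr j hj) sum_nth_line_lt.
Qed.
End Lines.

(** * Subgroups of order 4 *)

Lemma nim_mulE m (x y : nim m) : (x * y)%g = x ⊕ y :> nat.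
Proof. by []. Qed.

Lemma nim_inj m (x y : nim m) : x = y :> nat -> x = y.
Proof. by move=> e; do 2 apply: val_inj. Qed.

Lemma nim_abelem m : (2.-abelem [set: nim m]%G)%g.
Proof.
apply/abelemP => //; split=> [|x _].
  by apply/centsP => x _ y _; apply: nim_inj; rewrite !nim_mulE nimC.
by apply: nim_inj; rewrite nim_mulE nimxx.
Qed.

Lemma card_nim m : #|[set: nim m]%G| = 2 ^ m.
Proof.
rewrite cardsT -[RHS]card_ord; apply: (@bij_eq_card _ _ (@ord_of_nim m)).
by exists (@Nim m) => // -[].
Qed.

Definition klein (gT : finGroupType) (x y : gT) : {set gT} :=
  [set 1; x; y; x * y]%SET%g.

Lemma klein_group_set (gT : finGroupType) (x y : gT) :
  (2.-abelem [set: gT]%G)%g -> group_set (klein x y).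
Proof.
case/(abelemP (isT : prime 2)) => abel e2.
have sq (z : gT) : (z * z = 1)%g by exact: (e2 z (finset.in_setT z)).
have com (u v : gT) : (u * v = v * u)%g by apply: (centsP abel); rewrite inE.
have sqK (u v : gT) : (u * (u * v) = v)%g by rewrite mulgA sq mul1g.
have sqC (u v : gT) : (u * (v * u) = v)%g by rewrite (com v) sqK.
apply/group_setP; split=> [|u v]; rewrite !inE ?eqxx//.
rewrite -!orbA => /or4P[]/eqP-> /or4P[]/eqP->.
all: rewrite ?mul1g ?mulg1 ?sq ?(com (x * y)%g) ?sqK ?sqC ?sq ?(com y x).
all: by rewrite ?eqxx ?orbT.
Qed.

Lemma card_klein (gT : finGroupType) (x y : gT) : (x * x = 1)%g ->
  x != 1%g -> y != 1%g -> x != y -> #|klein x y| = 4.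
Proof.
move=> sq x1 y1 xy.
have /card_uniqP u : uniq [:: 1; x; y; x * y]%g.
  have e1 : (1 == x * y)%g = false by rewrite -sq (inj_eq (mulgI x)) (negPf xy).
  have ex : (x == x * y)%g = false.
    by apply: contraNF y1 => /eqP e; apply/eqP/(mulgI x); rewrite -e mulg1.
  have ey : (y == x * y)%g = false.
    by apply: contraNF x1 => /eqP e; apply/eqP/(mulIg y); rewrite -e mul1g.
  by rewrite /= !inE e1 ex ey ![1%g == _]eq_sym (negPf x1) (negPf y1) (negPf xy).
by rewrite -[4]u; apply: eq_card => z; rewrite !inE -!orbA.
Qed.

Lemma order4_klein (gT : finGroupType) (H : {group gT}) :
  (2.-abelem [set: gT]%G)%g -> #|H| = 4 ->
  exists x y : gT, [/\ x != 1%g, y != 1%g, x != y & H :=: klein x y].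
Proof.
move=> abT H4.
have /trivgPn[x xH x1] : H :!=: 1%g by rewrite trivg_card1 H4.
have /subsetPn[y yH] : ~~ (H \subset [set 1%g; x]%SET).
  apply: contraTN isT => /subset_leq_card.
  by rewrite H4 cards2; case: eqP.
rewrite !inE negb_or => /andP[y1 yx].
have [_ /(_ x (finset.in_setT x)) sq] := abelemP (isT : prime 2) abT.
rewrite eq_sym in yx; exists x, y; split=> //.
apply/esym/eqP; rewrite eqEcard card_klein// H4 leqnn andbT.
by apply/fintype.subsetP => z; rewrite !inE -!orbA => /or4P[]/eqP->//; rewrite groupM.
Qed.

Lemma nim_subset_klein m (x y : nim m) (H : {group nim m}) : H :=: klein x y ->
  nim_subset H = [set j | j = 0 \/ j \in tri x y].
Proof.
move=> e; apply/seteqP; split=> j /=.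
- case=> z + ->; rewrite e !inE -!orbA => /or4P[]/eqP->;
    by [left|right; rewrite ?nim_mulE eqxx ?orbT].
- case=> [->|]; first by exists 1%g => //; rewrite group1.
  rewrite mem_tri => /or3P[]/eqP->; [exists x|exists y|exists (x * y)%g] => //.
  all: by rewrite e !inE eqxx ?orbT.
Qed.

(** * Vector spaces over the field with two elements *)

(** Both groups are elementary abelian of order 2 ^ m, hence isomorphic, and V
    is a row space through [r2v]. *)
Lemma nim_coordinates (m : nat) (V : vectType 'F_2) : \dim {:V} = m ->
  exists g : nat -> V,
    [/\ {in gtn (2 ^ m) &, {morph g : x y / x ⊕ y >-> (x + y)%R}},
        {in gtn (2 ^ m) &, injective g}
      & forall v, exists2 x, x < 2 ^ m & g x = v].
Proof.
rewrite dimvf => <-; set p := dim V.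
have /isogP[f /injmP injf imf] :
    ([set: nim p]%SET \isog [set: 'rV['F_2]_p]%SET)%g.
  rewrite (isog_abelem_card _ (nim_abelem p)) mx_Fp_abelem//=.
  by rewrite card_nim cardsT card_mx card_Fp// mul1n.
(* the default value is used only for k outside the group *)
pose h k : nim p := Nim (insubd (ord_of_nim 1%g) k).
have hE k : k < 2 ^ p -> h k = k :> nat.
  by move=> hk; rewrite /h /= val_insubd hk.
exists (fun k => @r2v _ V (f (h k))); split.
- move=> x y hx hy.
  rewrite -raddfD -[(f _ + f _)%R]FinRing.zmodMgE -morphM ?inE//.
  congr (@r2v _ V (f _)); apply: nim_inj.
  by rewrite nim_mulE !hE// nim_bound.
- move=> x y hx hy /(can_inj r2vK) /injf.
  rewrite !inE => /(_ isT isT) /(congr1 (fun z : nim p => z : nat)).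
  by rewrite !hE.
- move=> v; have : v2r v \in (f @* [set: nim p]%SET)%g by rewrite imf inE.
  case/morphimP=> x _ _ e; exists x; first exact: ltn_ord.
  rewrite -[v]v2rK e; congr (@r2v _ V (f _)); apply: nim_inj.
  by rewrite hE.
Qed.

Lemma F2_cases (c : 'F_2) : c = 0%R \/ c = 1%R.
Proof. by case: c => -[|[|//]] i; [left|right]; apply: val_inj. Qed.

Local Open Scope ring_scope.

Lemma F2_line (V : vectType 'F_2) (v w : V) :
  (w \in <[v]>%VS) = (w == 0) || (w == v).
Proof.
apply/vlineP/orP => [[c ->]|[]/eqP->].
- by have [->|->] := F2_cases c; [left; rewrite scale0r|right; rewrite scale1r].
- by exists 0; rewrite scale0r.
- by exists 1; rewrite scale1r.
Qed.

Lemma F2_plane (V : vectType 'F_2) (u v w : V) :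
  (w \in <<[:: u; v]>>%VS) = [|| w == 0, w == u, w == v | w == u + v].
Proof.
rewrite span_cons span_seq1.
apply/memv_addP/or4P => [[x + [y + ->]]|].
  rewrite !F2_line => /orP[]/eqP-> /orP[]/eqP->; rewrite ?add0r ?addr0 ?eqxx.
  - by constructor 1.
  - by constructor 3.
  - by constructor 2.
  - by constructor 4.
case=> /eqP->.
- by exists 0; rewrite ?mem0v//; exists 0; rewrite ?mem0v ?addr0.
- by exists u; rewrite ?memv_line//; exists 0; rewrite ?mem0v ?addr0.
- by exists 0; rewrite ?mem0v//; exists v; rewrite ?memv_line ?add0r.
- by exists u; rewrite ?memv_line//; exists v; rewrite ?memv_line.
Qed.

Lemma dim_F2_plane (V : vectType 'F_2) (u v : V) : u != 0 -> v != 0 -> u != v ->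
  \dim <<[:: u; v]>> = 2.
Proof.
move=> u0 v0 uv; apply/eqP.
have : free [:: u; v].
  by rewrite free_cons seq1_free v0 span_seq1 F2_line (negPf u0) (negPf uv).
by rewrite /free.
Qed.

Lemma F2_plane_basis (V : vectType 'F_2) (U : {vspace V}) : \dim U = 2 ->
  exists u v, [/\ u != 0, v != 0, u != v & U = <<[:: u; v]>>%VS].
Proof.
move=> dU; have := vbasisP U; have := etrans (size_tuple (vbasis U)) dU.
case: (tval _) => [|u [|v []]] // _ B.
exists u, v; rewrite (span_basis B); split=> //.
all: have := basis_free B; rewrite free_cons seq1_free span_seq1 F2_line negb_or.
all: by case/andP=> /andP[].
Qed.

Lemma F2_point_basis (V : vectType 'F_2) (U : {vspace V}) : \dim U = 1 ->
  exists2 v, v != 0 & U = <[v]>%VS.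
Proof.
move=> dU; have := vbasisP U; have := etrans (size_tuple (vbasis U)) dU.
case: (tval _) => [|v []] // _ B.
exists v; last by rewrite -span_seq1 (span_basis B).
by have := basis_free B; rewrite seq1_free.
Qed.

Local Close Scope ring_scope.

(** * Rows as subgroups and as lines of the projective space *)

Lemma nth_line_pair m i : 0 < i <= size (lines m) -> exists p : nat * nat,
  [/\ 0 < p.1 < 2 ^ m, 0 < p.2 < 2 ^ m, p.1 != p.2 & nth_line m i = tri p.1 p.2].
Proof.
move=> /nth_line_in hl; set k := nth 0 _ _ in hl.
exists (fst_pt m k, snd_pt m k) => /=; split=> //.
- by apply: (line_bound hl); rewrite mem_tri eqxx.
- by apply: (line_bound hl); rewrite mem_tri eqxx orbT.
- by have /and3P[_ + _] := lines_ordered hl; rewrite neq_ltn => ->.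
Qed.

Lemma nth_line_of_pair m x y : 0 < x < 2 ^ m -> 0 < y < 2 ^ m -> x != y ->
  exists2 i, 0 < i <= size (lines m) & nth_line m i =i tri x y.
Proof.
move=> hx hy xy; have [k hk e] := line_of_pair hx hy xy.
by have [i hi ei] := nth_line_exists hk; exists i; rewrite // ei.
Qed.

Lemma nim_neq1 m (x : nim m) : (x != 1%g) = (0 < x < 2 ^ m).
Proof. by rewrite ltn_ord andbT lt0n. Qed.

Lemma rows_subgroups m : set_bij [set i | 1 <= i <= size (lines m)]
  (nim_subgroups m 4) (fun i => [set j | j = 0 \/ j \in nth_line m i]).
Proof.
have ab := nim_abelem m.
have kleinE (x y : nim m) : nim_subset (group (klein_group_set x y ab)) =
    [set j | j = 0 \/ j \in tri x y] by apply: nim_subset_klein.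
split.
- move=> i /= /nth_line_pair[[x y]] /=.
  move=> [/[dup] hx /andP[_ xN] /[dup] hy /andP[_ yN] xy ->].
  pose X := Nim (Ordinal xN); pose Y := Nim (Ordinal yN).
  have X1 : X != 1%g by rewrite nim_neq1.
  have Y1 : Y != 1%g by rewrite nim_neq1.
  have XY : X != Y by apply: contraNneq xy => e; rewrite -[x]/(X : nat) e.
  exists (group (klein_group_set X Y ab)); last exact: (kleinE X Y).
  rewrite /= card_klein//.
  by have [_ /(_ X (finset.in_setT X))] := abelemP (isT : prime 2) ab.
- move=> i i'; rewrite !inE /= => hi hi' e; apply: (nth_line_inj hi hi') => z.
  have row0 k : 0 < k <= size (lines m) -> z \in nth_line m k -> 0 < z.
    by move=> /nth_line_in hk /(line_bound hk) /andP[].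
  have : (z = 0 \/ z \in nth_line m i) = (z = 0 \/ z \in nth_line m i').
    by have := congr1 (fun A => A z) e.
  move=> ez; apply/idP/idP => zr.
    have : z = 0 \/ z \in nth_line m i' by rewrite -ez; right.
    by case=> // z0; have := row0 _ hi zr; rewrite z0.
  have : z = 0 \/ z \in nth_line m i by rewrite ez; right.
  by case=> // z0; have := row0 _ hi' zr; rewrite z0.
- move=> A [H /= H4 <-].
  have [x [y [x1 y1 xy e]]] := order4_klein ab H4.
  rewrite !nim_neq1 in x1 y1.
  have [|i hi ei] := nth_line_of_pair x1 y1.
    by apply: contraNneq xy => ?; apply/eqP/nim_inj.
  exists i => //; rewrite (nim_subset_klein e).
  by apply/seteqP; split=> j /=; rewrite ei.
Qed.

(** The isomorphism g turns the triple of x and y into the nonzero vectors of the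
    plane spanned by g x and g y, so all claims about points and lines of V
    transfer to the numbers below 2 ^ m. *)
Lemma rows_incidence (m : nat) (V : vectType 'F_2) (d s : nat) : \dim {:V} = m ->
  d = size (lines m) -> s = 2 ^ m - 1 ->
  incidence_matrix (PG_points (V := V)) (PG_lines (V := V))
    (PG_incident (V := V)) (\matrix_(i < d, j < s) (j.+1 \in nth_line m i.+1)).
Proof.
move=> dV -> {d} -> {s}.
have [g [gD ginj gsurj]] := nim_coordinates dV.
have N0 : 0 < 2 ^ m by rewrite expn_gt0.
have g0 : g 0 = 0%R.
  by apply: (addrI (g 0)); rewrite -gD ?inE// nim0x addr0.
have gE x y : x < 2 ^ m -> y < 2 ^ m -> (g x == g y) = (x == y).
  by move=> hx hy; apply/eqP/eqP => [/ginj|->//]; apply; rewrite ?inE.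
have gneq0 x : 0 < x < 2 ^ m -> g x != 0%R.
  by case/andP=> x0 xN; rewrite -g0 gE// -lt0n.
have spanE x y z : x < 2 ^ m -> y < 2 ^ m -> z < 2 ^ m ->
    (g z \in <<[:: g x; g y]>>%VS) = (z == 0) || (z \in tri x y).
  move=> hx hy hz; rewrite F2_plane -gD// -g0 !gE ?nim_bound//.
  by rewrite mem_tri.
have ordN (j : 'I_(2 ^ m - 1)) : 0 < j.+1 < 2 ^ m.
  by have := ltn_ord j; lia.
have ordd (i : 'I_(size (lines m))) : 0 < i.+1 <= size (lines m).
  exact: ltn_ord.
pose A (i : nat) := fst_pt m (nth 0%N (lines m) i).
pose B (i : nat) := snd_pt m (nth 0%N (lines m) i).
pose bl (i : 'I_(size (lines m))) := <<[:: g (A i); g (B i)]>>%VS.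
have rowB (i : 'I_(size (lines m))) z : z \in nth_line m i.+1 -> 0 < z < 2 ^ m.
  exact/line_bound/nth_line_in/ordd.
have AP (i : 'I_(size (lines m))) :
    [/\ 0 < A i < 2 ^ m, 0 < B i < 2 ^ m & A i != B i].
  have [[x y] /= [hx hy xy [ex ey _]]] := nth_line_pair (ordd i).
  by split; rewrite /A /B ?ex ?ey.
have blE (i : 'I_(size (lines m))) z : z < 2 ^ m ->
    (g z \in bl i) = (z == 0) || (z \in nth_line m i.+1).
  by move=> hz; have [/andP[_ AN] /andP[_ BN] _] := AP i; rewrite spanE.
exists (fun j => <[g j.+1]>%VS), bl; split.
- split.
  + by move=> j _; rewrite /PG_points /= dim_vline gneq0.
  + move=> j j' _ _ /= e; apply: val_inj => /=.
    have : g j.+1 \in <[g j'.+1]>%VS by rewrite -e memv_line.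
    rewrite F2_line (negPf (gneq0 _ (ordN j))) /= gE; last 2 first.
      by case/andP: (ordN j). by case/andP: (ordN j').
    by move/eqP=> [].
  + move=> U /= /F2_point_basis[v v0 ->]; have [x xN gx] := gsurj v.
    have x0 : 0 < x by rewrite lt0n; apply: contraNneq v0 => x0; rewrite -gx x0 g0.
    have hx : x.-1 < 2 ^ m - 1 by lia.
    by exists (Ordinal hx) => //=; rewrite prednK// gx.
- split.
  + move=> i _; rewrite /PG_lines /=.
    have [/andP[A0 AN] /andP[B0 BN] AB] := AP i.
    by rewrite dim_F2_plane ?gneq0 ?gE// ?A0 ?B0.
  + move=> i i' _ _ e; apply: val_inj => /=.
    have [] // : i.+1 = i'.+1.
    apply: (nth_line_inj (ordd i) (ordd i')) => z; apply/idP/idP => zr.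
      have /andP[z0 zN] := rowB _ _ zr.
      by have := blE i' z zN; rewrite -e blE// zr orbT gtn_eqF.
    have /andP[z0 zN] := rowB _ _ zr.
    by have := blE i z zN; rewrite e blE// zr orbT gtn_eqF.
  + move=> U /= /F2_plane_basis[u [v [u0 v0 uv ->]]].
    have [x xN gx] := gsurj u; have [y yN gy] := gsurj v.
    have x0 : 0 < x by rewrite lt0n; apply: contraNneq u0 => x0; rewrite -gx x0 g0.
    have y0 : 0 < y by rewrite lt0n; apply: contraNneq v0 => y0; rewrite -gy y0 g0.
    have xy : x != y by apply: contraNneq uv => e; rewrite -gx -gy e.
    have [|||[|i] // hi ei] := @nth_line_of_pair m x y; rewrite ?x0 ?y0//.
    exists (Ordinal hi) => //; apply/vspaceP => w.
    have [z zN <-] := gsurj w.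
    by rewrite blE// -gx -gy spanE// ei.
- move=> i j; rewrite mxE /PG_incident -memvE blE//.
  by case/andP: (ordN j).
Qed.

Theorem mainTheorem3 (n : nat) (a : nat -> nat -> bool) :
  1 <= n ->
  naive_matrix 3 (2 ^ n - 1) a ->
  let s := 2 ^ n.+1 - 1 in
  let d := ((2 ^ n.+1 - 1) * (2 ^ n - 1)) %/ 3 in
  [/\ (2.-abelem [set: nim n.+1]%G)%g,
      #|[set: nim n.+1]%G| = 2 ^ n.+1,
      set_bij [set i | 1 <= i <= d] (nim_subgroups n.+1 4)
        (fun i => row_support a i `|` [set 0])
    & forall V : vectType 'F_2, \dim {:V} = n.+1 ->
        incidence_matrix (PG_points (V := V)) (PG_lines (V := V))
          (PG_incident (V := V)) (upper_left d s a)].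
Proof.
move=> n1 na s d.
have n2 : 2 ^ n.+1 = (2 ^ n).*2 by rewrite expnS mul2n.
have pos : 1 < 2 ^ n by rewrite -{1}(expn0 2) ltn_exp2l.
have degr j : 0 < j < 2 ^ n.+1 -> deg n.+1 j = 2 ^ n - 1.
  by move=> /degE; rewrite n2; lia.
have dE : d = size (lines n.+1).
  have h1 : 0 < 1 < 2 ^ n.+1 by rewrite n2; lia.
  by rewrite /d -(degr 1 h1) -(size_lines h1) mulKn.
have aE := naive_rows degr na.
split.
- exact: nim_abelem.
- exact: card_nim.
- have bij := rows_subgroups n.+1; rewrite -dE in bij aE.
  apply: (eq_set_bijLR _ bij) => i; rewrite inE /= => hi.
  apply/seteqP; split=> j /=.
    by case=> [[j0]|->]; [rewrite aE//; right|left].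
  case=> [->|jr]; first by right.
  have hi' : 0 < i <= size (lines n.+1) by rewrite -dE.
  left; have /andP[j0 _] := line_bound (nth_line_in hi') jr.
  by split=> //; rewrite aE.
- move=> V dV; have := rows_incidence dV dE (erefl s).
  congr incidence_matrix; apply/matrixP => i j; rewrite !mxE aE// -dE.
  exact: ltn_ord.
Qed.
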